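(* Let $X$ be an infinite-dimensional real Banach space with norm $\|\cdot\|$. The following are equivalent. (a) $X$ is reflexive. (b) $WH_{\mathrm{lip}} = F_{\mathrm{lip}}$; that is, for every Lipschitz function $f: X\to\mathbb{R}$ and every $x\in X$, $f$ is $WH$-differentiable at $x$ if and only if $f$ is $F$-differentiable at $x$. (c) $WH_{\mathrm{dist}} = F_{\mathrm{dist}}$; that is, for every distance function $f$ on $X$ and every $x\in X$, $f$ is $WH$-differentiable at $x$ if and only if $f$ is $F$-differentiable at $x$.
   Context: Let $\mathcal{B}$ be a bornology on $X$, i.e. a family of bounded subsets of $X$ whose union is $X$. A function $f: X\to\mathbb{R}$ is $\mathcal{B}$-differentiable at $x\in X$ if there is $\Lambda\in X^*$ such that for each $B\in\mathcal{B}$, $\frac{1}{t}\bigl[f(x+th)-f(x)-\langle\Lambda,th\rangle\bigr]\to 0$ as $t\downarrow 0$, uniformly for $h\in B$. The bornologies used here are $WH$ (all weakly compact subsets of $X$; weak Hadamard differentiability) and $F$ (all bounded subsets of $X$; Fréchet differentiability). A distance function on $X$ is a function of the form $f(x)=d(x,C)=\inf_{c\in C}\|x-c\|$ with $C\subset X$ nonempty. *)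

(* Defs.v *)
From HB Require Import structures.
From mathcomp Require Import all_boot all_order all_algebra.
From mathcomp Require Import all_classical all_reals all_analysis.

Set Implicit Arguments.
Unset Strict Implicit.
Unset Printing Implicit Defensive.

Import Order.TTheory GRing.Theory Num.Theory.
Import numFieldNormedType.Exports.

Local Open Scope classical_set_scope.
Local Open Scope ring_scope.

Section Dual.
Context {R : realType}.

Definition continuous_functional (X : normedModType R) : {pred X -> R} :=
  [pred f : X -> R | `[< linear (f : X -> R^o) /\ continuous f >]].
Arguments continuous_functional X : clear implicits.

Record dual_space (X : normedModType R) := Dual {
  dual_fun :> X -> R;
  dual_funP : dual_fun \in continuous_functional X }.

Section DualLmodule.
Variable X : normedModType R.

HB.instance Definition _ := [isSub of dual_space X for @dual_fun X].
HB.instance Definition _ := [Choice of dual_space X by <:].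

Lemma continuous_functional_submod : submod_closed (continuous_functional X).
Proof.
split=> [|a f g /asboolP[lf cf] /asboolP[lg cg]]; apply/asboolP; split.
- by move=> a x y /=; rewrite scaler0 addr0.
- by move=> x; exact: cvg_cst.
- move=> b x y; rewrite !fctE lf lg !scalerDr !scalerA (mulrC a b).
  by rewrite addrACA.
- move=> x; apply: cvgD; last exact: cg.
  by apply: cvgMl_tmp; exact: cf.
Qed.

HB.instance Definition _ := GRing.isSubmodClosed.Build R (X -> R)
  (continuous_functional X) continuous_functional_submod.
HB.instance Definition _ := [SubChoice_isSubLmodule of dual_space X by <:].

Definition dual_norm (f : dual_space X) : R :=
  sup [set `|f x| | x in [set x : X | `|x| <= 1]].

Lemma dual_linear (f : dual_space X) : linear (f : X -> R^o).
Proof. by have /asboolP[] := dual_funP f. Qed.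

Lemma dual_continuous (f : dual_space X) : continuous f.
Proof. by have /asboolP[] := dual_funP f. Qed.

HB.instance Definition _ (f : dual_space X) :=
  GRing.isLinear.Build R X R^o _ (f : X -> R^o) (dual_linear f).

Lemma dual_norm_has_sup (f : dual_space X) :
  has_sup [set `|f x| | x in [set x : X | `|x| <= 1]].
Proof.
split; first by exists `|f 0|, 0 => //=; rewrite normr0.
have /linear_bounded_continuous/bounded_funP/(_ 1)[M fM] :
  continuous (f : X -> R^o) := @dual_continuous f.
by exists M => _ [x /= x1 <-]; exact: fM.
Qed.

Lemma dual_norm_ub (f : dual_space X) (x : X) : `|f x| <= dual_norm f * `|x|.
Proof.
have [->|x0] := eqVneq x 0.
  by rewrite (linear0 (f : {linear X -> R^o})) !normr0 mulr0.
have nx0 : 0 < `|x| by rewrite normr_gt0.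
rewrite -ler_pdivrMr//; apply: sup_upper_bound; first exact: dual_norm_has_sup.
exists (`|x|^-1 *: x) => /=.
  by rewrite normrZ normfV normr_id mulVf ?gt_eqF.
rewrite (linearZ_LR (f : {linear X -> R^o})) normrZ normfV normr_id.
by rewrite mulrC.
Qed.

Lemma dual_norm_le (f : dual_space X) (M : R) :
  (forall x, `|x| <= 1 -> `|f x| <= M) -> dual_norm f <= M.
Proof.
move=> fM; apply: ge_sup; first by have [] := dual_norm_has_sup f.
by move=> _ [x /= x1 <-]; exact: fM.
Qed.

Lemma dual_norm_ge0 (f : dual_space X) : 0 <= dual_norm f.
Proof.
apply: (le_trans (normr_ge0 (f 0))); apply: sup_upper_bound.
  exact: dual_norm_has_sup.
by exists 0 => //=; rewrite normr0.
Qed.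

Lemma dual_norm_ub1 (f : dual_space X) (x : X) :
  `|x| <= 1 -> `|f x| <= dual_norm f.
Proof.
by move=> x1; rewrite (le_trans (dual_norm_ub f x))// ler_piMr// dual_norm_ge0.
Qed.

Lemma dual_normD (f g : dual_space X) :
  dual_norm (f + g) <= dual_norm f + dual_norm g.
Proof.
apply: dual_norm_le => x x1; rewrite (le_trans (ler_normD _ _))//.
by rewrite lerD// dual_norm_ub1.
Qed.

Lemma dual_normZ_le (a : R) (f : dual_space X) :
  dual_norm (a *: f) <= `|a| * dual_norm f.
Proof.
apply: dual_norm_le => x x1.
by rewrite [X in `|X|](_ : _ = a * f x)// normrM ler_wpM2l// dual_norm_ub1.
Qed.

Lemma dual_normZ (a : R) (f : dual_space X) :
  dual_norm (a *: f) = `|a| * dual_norm f.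
Proof.
apply/eqP; rewrite eq_le dual_normZ_le/=.
have [->|a0] := eqVneq a 0; first by rewrite normr0 mul0r dual_norm_ge0.
rewrite -ler_pdivlMl ?normr_gt0// -normfV.
by rewrite -{1}[f](scalerK a0) dual_normZ_le.
Qed.

Lemma dual_norm0_eq0 (f : dual_space X) : dual_norm f = 0 -> f = 0.
Proof.
move=> f0; apply/val_inj/funext => x /=; apply/eqP; rewrite -normr_le0.
by rewrite (le_trans (dual_norm_ub f x))// f0 mul0r.
Qed.

HB.instance Definition _ := Lmodule_isNormed.Build R (dual_space X)
  dual_normD dual_normZ dual_norm0_eq0.

Lemma eval_functional_proof (x : X) :
  (fun f : dual_space X => f x) \in continuous_functional (dual_space X).
Proof.
apply/asboolP; have lx : linear ((fun f => f x) : dual_space X -> R^o) by [].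
split=> //.
pose e : {linear dual_space X -> R^o} :=
  HB.pack ((fun f => f x) : dual_space X -> R^o)
    (GRing.isLinear.Build _ _ _ _ _ lx).
apply: (@bounded_linear_continuous R (dual_space X) R^o e); apply/bounded_funP => r.
exists (r * `|x|) => f fr; rewrite (le_trans (dual_norm_ub f x))//.
by rewrite ler_wpM2r.
Qed.

Definition canonical_embedding (x : X) : dual_space (dual_space X) :=
  Dual (eval_functional_proof x).

End DualLmodule.
End Dual.

Section Notions.
Context {R : realType}.
Implicit Type X : normedModType R.

Definition reflexive_space X :=
  range (@canonical_embedding R X) = [set: dual_space (dual_space X)].

Definition infinite_dimensional X := ~ exists (n : nat) (e : 'I_n -> X),
  forall x, exists c : 'I_n -> R, x = \sum_(i < n) c i *: e i.

(** The coarsest topology making every element of the dual continuous: the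
    supremum of the initial topologies of the individual functionals. *)
Definition weak_space X : Type := sup_topology (fun L : dual_space X =>
  Topological.class (initial_topology (L : X -> R))).

HB.instance Definition _ X := Topological.on (weak_space X).

Definition weakly_compact X (A : set X) := compact (A : set (weak_space X)).

Definition born_differentiable X (BB : set (set X)) (f : X -> R) (x : X) :=
  exists L : dual_space X, forall B, BB B ->
    {uniform B, (fun (t : R) (h : X) =>
        t^-1 * (f (x + t *: h) - f x - L (t *: h))) @ 0^'+ --> cst 0}.

Definition WH_differentiable X := born_differentiable (@weakly_compact X).

Definition F_differentiable X :=
  born_differentiable (bounded_set : set (set X)).

Definition distance_function X (f : X -> R) := exists C : set X,
  C !=set0 /\ f = fun x => inf [set `|x - c| | c in C].

End Notions.

(* Main.v *)
Require Import Defs.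
From HB Require Import structures.
From mathcomp Require Import all_boot all_order all_algebra.
From mathcomp Require Import all_classical all_reals all_analysis.
From mathcomp Require Import lra.
Import Order.TTheory GRing.Theory Num.Theory.
Import numFieldNormedType.Exports.
Local Open Scope classical_set_scope.
Local Open Scope ring_scope.

(** If X is reflexive its balls are weakly compact, and weakly compact sets are
    always bounded, so the two bornologies give the same differentiability.
    If X is not reflexive, some Phi in X** is at distance > 3 delta from X, and
    alternating Hahn-Banach with Helly's theorem yields (James) a bounded
    sequence x_n in X and functionals f_m in the dual ball with
    f_m(x_n) >= 3 delta for m <= n and f_m(x_n) = 0 for n < m.  No weakly compact
    set comes within delta of infinitely many x_n.  Removing from X the balls of
    centre x_n / (n+1) and radius delta / (n+1) leaves a set C whose distance
    function is at least delta / (n+1) at x_n / (n+1), so it is not Frechet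
    differentiable at 0; but for W weakly compact and t small, t W meets only
    those removed balls on which the distance function is o(t), so the weak
    Hadamard derivative at 0 is 0. *)

(** * Sublinear maps and the Hahn-Banach theorem *)

Definition sublinear {R : realType} {V : lmodType R} (q : V -> R) :=
  (forall x y, q (x + y) <= q x + q y) /\
  (forall a x, 0 <= a -> q (a *: x) = a * q x).

Lemma sublinear0 {R : realType} {V : lmodType R} {q : V -> R} :
  sublinear q -> q 0 = 0.
Proof. by case=> _ /(_ 0 0 (lexx _)); rewrite scale0r mul0r. Qed.

Lemma sublinear_opp {R : realType} {V : lmodType R} {q : V -> R} (x : V) :
  sublinear q -> - q (- x) <= q x.
Proof.
move=> qs; have := qs.1 x (- x); rewrite subrr (sublinear0 qs); lra.
Qed.

(** For [a > 0] the reverse inequality is the hypothesis applied to [a^-1] and [a *: x]. For infima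
    only one direction then has to be checked. *)
Lemma sublinear_le_homogeneous {R : realType} {V : lmodType R} {q : V -> R} :
  (forall a x, 0 <= a -> q (a *: x) <= a * q x) -> q 0 = 0 ->
  forall a x, 0 <= a -> q (a *: x) = a * q x.
Proof.
move=> qh q0 a x; rewrite le_eqVlt => /predU1P[<-|a0].
  by rewrite scale0r mul0r.
apply/eqP; rewrite eq_le (qh _ _ (ltW a0))/= -ler_pdivlMl//.
rewrite (le_trans _ (qh _ _ _)) ?invr_ge0 ?(ltW a0)//.
by rewrite scalerA mulVf ?scale1r ?gt_eqF.
Qed.

(** A pair [(v, r)] stands for the constraint [r <= g v] on a functional [g] to be found. *)
Definition convex_cone {R : realType} {V : lmodType R} (S : set (V * R)) :=
  [/\ S 0, (forall u v, S u -> S v -> S (u.1 + v.1, u.2 + v.2)) &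
      (forall a u, 0 <= a -> S u -> S (a *: u.1, a * u.2))].

(* [p x] is the infimum of [q (x + v) - r] over [(v, r)] in [S].  For [S] a ray
   of the graph of [q] this shows that minimal sublinear maps are linear; for
   [S] the graph of a functional it gives Hahn-Banach extensions. *)
Lemma sublinear_cone_inf {R : realType} {V : lmodType R} {q : V -> R}
    {S : set (V * R)} :
  sublinear q -> convex_cone S -> (forall u, S u -> u.2 <= q u.1) ->
  exists p : V -> R, [/\ sublinear p, (forall x, p x <= q x) &
    (forall u, S u -> p (- u.1) <= - u.2)].
Proof.
move=> qs [S0 SD SZ] Sq.
pose A x := [set q (x + u.1) - u.2 | u in S].
(* Since [r <= q v <= q (x + v) + q (- x)], the infimum is a genuine one and not the default value
   of [inf]. *)
have lbA x : lbound (A x) (- q (- x)).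
  move=> _ [u Su <-].
  have := qs.1 (x + u.1) (- x); rewrite addrAC subrr add0r.
  by have := Sq _ Su; lra.
have A0 x : A x !=set0 by exists (q (x + 0) - 0), 0.
have infA x u : S u -> inf (A x) <= q (x + u.1) - u.2.
  by move=> Su; apply: ge_inf; [exists (- q (- x)); exact: lbA | exists u].
have pq x : inf (A x) <= q x.
  by have := infA x 0 S0; rewrite addr0 subr0.
have pD x y : inf (A (x + y)) <= inf (A x) + inf (A y).
  rewrite -lerBlDr; apply: lb_le_inf => // _ [u Su <-].
  rewrite lerBlDr -lerBlDl; apply: lb_le_inf => // _ [v Sv <-].
  have := infA (x + y) _ (SD _ _ Su Sv); rewrite /= addrACA.
  by have := qs.1 (x + u.1) (y + v.1); lra.
have p0 : inf (A 0) = 0.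
  apply/eqP; rewrite eq_le; apply/andP; split.
    by rewrite (le_trans (pq 0))// (sublinear0 qs).
  by apply: lb_le_inf => // r /lbA; rewrite oppr0 (sublinear0 qs) oppr0.
exists (fun x => inf (A x)); split => //.
- split=> //; apply: sublinear_le_homogeneous => // a x.
  rewrite le_eqVlt => /predU1P[<-|a0]; first by rewrite scale0r mul0r p0.
  rewrite -ler_pdivrMl//; apply: lb_le_inf => // _ [u Su <-].
  rewrite ler_pdivrMl// (le_trans (infA _ _ (SZ _ _ (ltW a0) Su)))//=.
  by rewrite -scalerDr qs.2 ?mulrBr// ltW.
- by move=> u Su; have := infA (- u.1) _ Su; rewrite addNr (sublinear0 qs) sub0r.
Qed.

(** Zorn's lemma gives a minimal sublinear map below [q]; minimality makes it odd, and an odd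
    sublinear map is linear. *)
Lemma exists_linear_le_sublinear {R : realType} {V : lmodType R} {q : V -> R} :
  sublinear q ->
  exists g : V -> R^o, linear g /\ forall x, (g x : R) <= q x.
Proof.
move=> qs.
pose T := {m : V -> R | sublinear m /\ forall x, m x <= q x}.
(* The order is reversed, so that a maximal element for [r] is a minimal map. *)
pose r (m m' : T) := `[< forall x, sval m' x <= sval m x >].
have [||||m mmin] := @Zorn T r.
- by move=> m; apply/asboolP.
- move=> m1 m2 m3 /asboolP m12 /asboolP m23; apply/asboolP => x.
  exact: le_trans (m23 x) (m12 x).
- move=> [m1 p1] [m2 p2] /asboolP/= m12 /asboolP/= m21; apply: eq_exist.
  by apply/funext => x; apply/eqP; rewrite eq_le m12 m21.
- move=> A Atot; have [->|/set0P[m0 Am0]] := eqVneq A set0.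
    by exists (exist _ q (conj qs (fun=> lexx _))).
  pose B x := [set sval m x | m in A].
  have B0 x : B x !=set0 by exists (sval m0 x), m0.
  have lbB x : lbound (B x) (- q (- x)).
    move=> _ [[m [ms mq]] Am <-] /=.
    by apply: le_trans (sublinear_opp x ms); rewrite lerN2.
  have infB x m : A m -> inf (B x) <= sval m x.
    by move=> Am; apply: ge_inf; [exists (- q (- x)); exact: lbB | exists m].
  have Bs : sublinear (fun x => inf (B x)) /\ forall x, inf (B x) <= q x.
    split; last by move=> x; apply: (le_trans (infB x _ Am0)); exact: (svalP m0).2.
    split.
      move=> x y; rewrite -lerBlDr; apply: lb_le_inf => // _ [m Am <-].
      rewrite lerBlDr -lerBlDl; apply: lb_le_inf => // _ [m' Am' <-].
      (* The smaller of the two maps serves at both points, so its own subadditivity suffices. *)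
      rewrite lerBlDr; case: (Atot _ _ Am Am') => /asboolP mm'.
        apply: le_trans (infB _ _ Am') _; apply: le_trans ((svalP m').1.1 x y) _.
        by rewrite addrC lerD2l.
      apply: le_trans (infB _ _ Am) _; apply: le_trans ((svalP m).1.1 x y) _.
      by rewrite addrC lerD2r.
    have inf0 : inf (B 0) = 0.
      have -> : B 0 = [set 0]; last by rewrite inf1.
      apply/seteqP; split=> [_ [m Am <-]|_ ->] /=.
        exact: (sublinear0 (svalP m).1).
      by exists m0 => //; exact: (sublinear0 (svalP m0).1).
    apply: sublinear_le_homogeneous => // a x.
    rewrite le_eqVlt => /predU1P[<-|a0]; first by rewrite scale0r mul0r inf0.
    rewrite -ler_pdivrMl//; apply: lb_le_inf => // _ [m Am <-].
    by rewrite ler_pdivrMl// -((svalP m).1.2 a x (ltW a0)); exact: infB.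
  exists (exist _ (fun x => inf (B x)) Bs) => m Am; apply/asboolP => x /=.
  exact: infB.
case: m mmin => m [ms mq] /= mmin.
have mN y : m (- y) = - m y.
  apply/eqP; rewrite eq_le; apply/andP; split; last first.
    by have := sublinear_opp (- y) ms; rewrite opprK.
  (* Lowering [m] along the ray through [(y, m y)] gives [p <= m] with [p (- y) <= - m y];
     minimality forces [p = m]. *)
  pose S := [set (t *: y, t * m y) | t in [set t : R | 0 <= t]].
  have Scone : convex_cone S.
    split.
    - by exists 0 => //=; rewrite scale0r mul0r.
    - move=> _ _ [s /= s0 <-] [t /= t0 <-] /=; exists (s + t).
        by rewrite /= addr_ge0.
      by rewrite scalerDl mulrDl.
    - move=> a _ /= a0 [t /= t0 <-] /=; exists (a * t); first exact: mulr_ge0.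
      by rewrite scalerA mulrA.
  have Sm u : S u -> u.2 <= m u.1 by case=> t /= t0 <- /=; rewrite ms.2.
  have [p [ps pm pS]] := sublinear_cone_inf ms Scone Sm.
  have pq : sublinear p /\ forall x, p x <= q x.
    by split=> // x; exact: le_trans (pm x) (mq x).
  have := mmin (exist _ p pq) (introT (asboolP _) pm).
  move=> /(congr1 sval) /= pE; rewrite -{1}pE.
  have := pS (1 *: y, 1 * m y); rewrite /= scale1r mul1r; apply.
  by exists 1 => //=; rewrite scale1r mul1r.
exists m; split=> // a x y.
have mD u v : m (u + v) = m u + m v.
  apply/eqP; rewrite eq_le ms.1/=.
  have := ms.1 (- u) (- v); rewrite -opprD !mN; lra.
rewrite mD; congr (_ + _).
have [a0|a0] := leP 0 a; first by rewrite ms.2.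
have -> : a *: x = - ((- a) *: x) by rewrite scaleNr opprK.
by rewrite mN ms.2 ?oppr_ge0 ?ltW// mulNr opprK.
Qed.

(** A linear [g] below the infimum [p] satisfies [g (- v) <= p (- v) <= - r], that is, [r <= g v].
    Extension and separation both follow by choosing the cone. *)
Theorem hahn_banach_cone {R : realType} {V : lmodType R} {q : V -> R}
    {S : set (V * R)} :
  sublinear q -> convex_cone S -> (forall u, S u -> u.2 <= q u.1) ->
  exists g : V -> R^o, [/\ linear g, (forall x, (g x : R) <= q x) &
    (forall u, S u -> u.2 <= g u.1)].
Proof.
move=> qs Sc Sq; have [p [ps pq pS]] := sublinear_cone_inf qs Sc Sq.
have [g [lg gp]] := exists_linear_le_sublinear ps; exists g; split=> //.
  by move=> x; exact: le_trans (gp x) (pq x).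
move=> u Su; have gN x : g (- x) = - g x.
  by have := lg (-1) x 0; rewrite !scaleN1r addr0 => ->; 
     have := lg 1 0 0; rewrite !scale1r addr0; lra.
by have := le_trans (gp _) (pS _ Su); rewrite gN lerN2.
Qed.

(** * Extension and separation by continuous functionals *)

Lemma dual_spaceD {R : realType} {X : normedModType R} (f : dual_space X) x y :
  f (x + y) = f x + f y.
Proof. exact: (linearD (f : {linear X -> R^o})). Qed.

Lemma dual_spaceN {R : realType} {X : normedModType R} (f : dual_space X) x :
  f (- x) = - f x.
Proof. exact: (linearN (f : {linear X -> R^o})). Qed.

Lemma dual_spaceB {R : realType} {X : normedModType R} (f : dual_space X) x y :
  f (x - y) = f x - f y.
Proof. by rewrite dual_spaceD dual_spaceN. Qed.

Lemma dual_spaceZ {R : realType} {X : normedModType R} (f : dual_space X) a x :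
  f (a *: x) = a * f x.
Proof. exact: (linearZ_LR (f : {linear X -> R^o})). Qed.

Lemma dual_space0 {R : realType} {X : normedModType R} (f : dual_space X) :
  f 0 = 0.
Proof. exact: (linear0 (f : {linear X -> R^o})). Qed.

Lemma exists_dual {R : realType} {X : normedModType R} {g : X -> R^o} {C : R} :
  linear g -> (forall x, (g x : R) <= C * `|x|) ->
  exists2 f : dual_space X, (f : X -> R) = g & forall x, `|f x| <= C * `|x|.
Proof.
move=> lg gC.
pose g' : {linear X -> R^o} := HB.pack g (GRing.isLinear.Build _ _ _ _ _ lg).
have gC' x : `|g x : R| <= C * `|x|.
  rewrite ler_norml gC andbT lerNl.
  have <- : g (- x) = - g x by exact: (linearN g').
  by rewrite -(normrN x).
have gP : g \in @continuous_functional R X.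
  apply/asboolP; split=> //.
  apply: (@bounded_linear_continuous R X R^o g'); apply/bounded_funP => r.
  exists (`|C| * r) => x xr; rewrite (le_trans (gC' x))//.
  by rewrite (le_trans (ler_wpM2r (normr_ge0 x) (ler_norm C)))// ler_wpM2l.
by exists (Dual gP).
Qed.

Lemma sublinear_norm {R : realType} {X : normedModType R} {C : R} :
  0 <= C -> sublinear (fun x : X => C * `|x|).
Proof.
move=> C0; split=> [x y|a x a0]; first by rewrite -mulrDr ler_wpM2l// ler_normD.
by rewrite normrZ ger0_norm// mulrCA.
Qed.

Definition submodule {R : realType} {V : lmodType R} (A : set V) :=
  A 0 /\ forall a u v, A u -> A v -> A (a *: u + v).

Lemma submoduleZ {R : realType} {V : lmodType R} {A : set V} a u :
  submodule A -> A u -> A (a *: u).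
Proof. by move=> [A0 AZ] Au; rewrite -[_ *: _]addr0; exact: AZ. Qed.

Lemma submoduleD {R : realType} {V : lmodType R} {A : set V} u v :
  submodule A -> A u -> A v -> A (u + v).
Proof. by move=> [_ AZ] Au; rewrite -[u in u + v]scale1r; exact: AZ. Qed.

(** The cone is the graph of [phi] over [V]. It yields [phi <= f] on [V], and equality because [V]
    is symmetric. *)
Lemma dual_extension {R : realType} {X : normedModType R} {V : set X}
    {phi : dual_space X} {C : R} :
  0 <= C -> submodule V -> (forall v, V v -> phi v <= C * `|v|) ->
  exists2 f : dual_space X, (forall x, `|f x| <= C * `|x|) &
    forall v, V v -> f v = phi v.
Proof.
move=> C0 sV phiC; pose S := [set (v, phi v) | v in V].
have Scone : convex_cone S.
  split.
  - by exists 0; [exact: sV.1 | rewrite dual_space0].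
  - move=> _ _ [u Vu <-] [v Vv <-]; exists (u + v); last by rewrite dual_spaceD.
    exact: submoduleD.
  - move=> a _ _ [u Vu <-]; exists (a *: u); last by rewrite dual_spaceZ.
    exact: submoduleZ.
have [|g [lg gC gS]] := hahn_banach_cone (sublinear_norm C0) Scone.
  by move=> _ [v Vv <-]; exact: phiC.
have [f fg fC] := exists_dual lg gC; exists f => // v Vv.
have gphi u : V u -> phi u <= f u.
  by move=> Vu; rewrite fg; apply: (gS (u, phi u)); exists u.
apply/eqP; rewrite eq_le gphi// andbT -lerN2 -!dual_spaceN; apply: gphi.
by rewrite -scaleN1r; exact: submoduleZ.
Qed.

(** The constraints [t * d <= g (t *: y + v)] are compatible with the norm: for [t > 0], factoring
    out [t] leaves the distance from [y] to a point of [V]. Taking [t = 0] makes [g] vanish on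
    [V]. *)
Lemma dual_separation {R : realType} {X : normedModType R} {V : set X} {y : X}
    {d : R} :
  submodule V -> (forall v, V v -> d <= `|y - v|) ->
  exists f : dual_space X, [/\ (forall x, `|f x| <= `|x|),
    (forall v, V v -> f v = 0) & d <= f y].
Proof.
move=> sV dV.
pose S := [set (t *: y + v, t * d) | t in [set t : R | 0 <= t] & v in V].
have Scone : convex_cone S.
  split.
  - by exists 0 => //=; exists 0; [exact: sV.1 | rewrite scale0r mul0r addr0].
  - move=> _ _ [s /= s0 [u Vu <-]] [t /= t0 [v Vv <-]].
    exists (s + t); first exact: addr_ge0.
    exists (u + v); first exact: submoduleD.
    by rewrite scalerDl mulrDl addrACA.
  - move=> a _ /= a0 [t /= t0 [v Vv <-]].
    exists (a * t); first exact: mulr_ge0.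
    exists (a *: v); first exact: submoduleZ.
    by rewrite scalerDr scalerA mulrA.
have Sle u : S u -> u.2 <= 1 * `|u.1|.
  move=> [t /= + [v Vv <-]] /=; rewrite mul1r le_eqVlt => /predU1P[<-|t0].
    by rewrite mul0r.
  rewrite -ler_pdivlMl// -[t^-1]ger0_norm ?invr_ge0 ?(ltW t0)// -normrZ.
  rewrite scalerDr scalerA mulVf ?gt_eqF// scale1r -[X in _ + X]opprK.
  by apply: dV; rewrite -scaleNr; exact: submoduleZ.
have [g [lg gC gS]] := hahn_banach_cone (sublinear_norm ler01) Scone Sle.
have [f fg fC] := exists_dual lg gC; exists f.
have fV v : V v -> 0 <= f v.
  move=> Vv; rewrite fg; apply: (gS (v, 0)); exists 0 => //=; exists v => //.
  by rewrite scale0r mul0r add0r.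
split=> [x|v Vv|].
- by rewrite -[leRHS]mul1r.
- apply/eqP; rewrite eq_le fV// andbT -oppr_ge0 -dual_spaceN; apply: fV.
  by rewrite -scaleN1r; exact: submoduleZ.
- rewrite fg; apply: (gS (y, d)); exists 1 => //=; exists 0; first exact: sV.1.
  by rewrite scale1r mul1r addr0.
Qed.

Lemma exists_dual_norm {R : realType} {X : normedModType R} (y : X) :
  exists2 f : dual_space X, (forall x, `|f x| <= `|x|) & `|y| <= f y.
Proof.
have [| |f [fx _ fy]] := @dual_separation R X [set 0] y `|y|.
- by split=> // a _ _ -> ->; rewrite scaler0 addr0.
- by move=> _ ->; rewrite subr0.
- by exists f.
Qed.

(** * Finite systems of functionals and Helly's theorem *)

(** Induction on [fs]: subtracting a multiple of [f] from [g] leaves a functional vanishing on the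
    common kernel of the tail. The submodule [P] replaces explicit linear combinations. *)
Lemma dual_span_of_kernels {R : realType} {Y : normedModType R}
    {P : set (dual_space Y)} (fs : seq (dual_space Y)) (g : dual_space Y) :
  submodule P -> (forall f, f \in fs -> P f) ->
  (forall v, (forall f, f \in fs -> f v = 0) -> g v = 0) -> P g.
Proof.
move=> sP; elim: fs g => [|f fs IH] g Pfs gker.
  have -> : g = 0; last exact: sP.1.
  by apply/val_inj/funext => v; exact: gker.
have Pfs' f' : f' \in fs -> P f'.
  by move=> f'fs; apply: Pfs; rewrite inE f'fs orbT.
have [[u [ufs fu]]|nou] :=
    pselect (exists u, (forall f', f' \in fs -> f' u = 0) /\ f u != 0).
  have -> : g = (g u / f u) *: f + (g - (g u / f u) *: f) by rewrite addrC subrK.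
  apply: sP.2; first by apply: Pfs; rewrite inE eqxx.
  apply: IH => // v vfs.
  have : g (v - (f v / f u) *: u) = 0.
    apply: gker => f'; rewrite inE dual_spaceB dual_spaceZ => /predU1P[->|f'fs].
      by rewrite divfK// subrr.
    by rewrite (vfs _ f'fs) (ufs _ f'fs) mulr0 subr0.
  rewrite dual_spaceB dual_spaceZ => gv.
  rewrite -[LHS]/(g v - (g u / f u) * f v) -[RHS]gv.
  by rewrite mulrAC [f v / _ * _]mulrAC [f v * _]mulrC.
apply: IH => // v vfs; apply: gker => f'; rewrite inE.
move=> /predU1P[->|]; last exact: vfs.
by apply/eqP; apply: contrapT => /negP fv; apply: nou; exists v.
Qed.

(** Otherwise [Phi] is bounded by [theta] on the annihilator of [xs], and its restriction extends to
    some [Psi] of norm at most [theta]. Then [Phi - Psi] vanishes on that annihilator, hence comes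
    from a point of [X], which lies too close to [Phi]. *)
Lemma annihilator_norming {R : realType} {X : normedModType R}
    {Phi : dual_space (dual_space X)} {theta : R} (xs : seq X) :
  0 <= theta -> (forall x, theta < `|Phi - canonical_embedding x|) ->
  exists f : dual_space X,
    [/\ `|f| <= 1, theta <= Phi f & forall x, x \in xs -> f x = 0].
Proof.
move=> theta0 far; apply: contrapT => nof.
pose V := [set f : dual_space X | forall x, x \in xs -> f x = 0].
have sV : submodule V.
  split=> // a f g fV gV x xxs; rewrite -[LHS]/(a * f x + g x).
  by rewrite fV// gV// mulr0 addr0.
have PhiV f : V f -> Phi f <= theta * `|f|.
  move=> fV; have [->|f0] := eqVneq f 0.
    by rewrite dual_space0 normr0 mulr0.
  have nf0 : 0 < `|f| by rewrite normr_gt0.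
  rewrite leNgt; apply/negP => fPhi; apply: nof; exists (`|f|^-1 *: f); split.
  - by rewrite normrZ normfV normr_id mulVf ?gt_eqF.
  - by rewrite dual_spaceZ ler_pdivlMl// mulrC ltW.
  - by move=> x /fV fx; rewrite -[LHS]/(_ * f x) fx mulr0.
have [Psi Psi_theta PsiV] := dual_extension theta0 sV PhiV.
have : range (@canonical_embedding R X) (Phi - Psi).
  apply: (@dual_span_of_kernels R (dual_space X) _
            [seq canonical_embedding x | x <- xs]).
  - split; first by exists 0 => //; apply/val_inj/funext => f; exact: dual_space0.
    move=> a _ _ [x _ <-] [y _ <-]; exists (a *: x + y) => //.
    by apply/val_inj/funext => f /=; rewrite dual_spaceD dual_spaceZ.
  - by move=> _ /mapP[x _ ->]; exists x.
  - move=> f fxs; rewrite -[LHS]/(Phi f - Psi f) PsiV ?subrr// => x xxs.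
    by have := fxs (canonical_embedding x) (map_f _ xxs).
case=> x _ xE; have := far x; rewrite xE opprB addrC subrK ltNge => /negP; apply.
apply: dual_norm_le => f f1; apply: (le_trans (Psi_theta f)).
by rewrite ler_piMr.
Qed.

(* First solve the linear system [f x = Phi f] ignoring the norm, then move the
   solution along the common kernel to make its norm almost minimal. *)
Lemma helly {R : realType} {X : normedModType R}
    (Phi : dual_space (dual_space X)) (fs : seq (dual_space X)) :
  exists2 x : X, `|x| <= `|Phi| + 1 & forall f, f \in fs -> f x = Phi f.
Proof.
have [x0 x0fs] : exists x, forall f, f \in fs -> f x = Phi f.
  elim: fs => [|f fs [x xfs]]; first by exists 0.
  have [[u [ufs fu]]|nou] :=
      pselect (exists u, (forall f', f' \in fs -> f' u = 0) /\ f u != 0).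
    exists (x + ((Phi f - f x) / f u) *: u) => f'.
    rewrite inE dual_spaceD dual_spaceZ.
    move=> /predU1P[->|f'fs]; first by rewrite divfK// addrC subrK.
    by rewrite (ufs _ f'fs) mulr0 addr0 xfs.
  exists x => f'; rewrite inE => /predU1P[->|]; last exact: xfs.
  apply: (@dual_span_of_kernels R X [set g : dual_space X | g x = Phi g] fs f).
  - split=> [|a g h /= gx hx] /=; first by rewrite dual_space0.
    by rewrite dual_spaceD dual_spaceZ -gx -hx.
  - exact: xfs.
  by move=> v vfs; apply/eqP; apply: contrapT => /negP fv; apply: nou; exists v.
(* If every solution were too long, [x0] would be at distance at least [|Phi| + 1] from the common
   kernel. A separating [g] of norm at most 1 would give [|Phi| + 1 <= g x0 = Phi g <= |Phi|]. *)
apply: contrapT => nox.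
pose V := [set v : X | forall f, f \in fs -> f v = 0].
have sV : submodule V.
  split=> [f _|a u v uV vV f ffs]; first exact: dual_space0.
  by rewrite dual_spaceD dual_spaceZ uV// vV// mulr0 addr0.
have x0V v : V v -> `|Phi| + 1 <= `|x0 - v|.
  move=> vV; rewrite leNgt; apply/negP => /ltW small; apply: nox.
  by exists (x0 - v) => // f ffs; rewrite dual_spaceB x0fs// vV// subr0.
have [g [g1 gV gx0]] := dual_separation sV x0V.
have gPhi : g x0 = Phi g.
  apply: (@dual_span_of_kernels R X [set f : dual_space X | f x0 = Phi f] fs g).
  - split=> [|a f h /= fx hx] /=; first by rewrite dual_space0.
    by rewrite dual_spaceD dual_spaceZ -fx -hx.
  - exact: x0fs.
  - exact: gV.
have : Phi g <= `|Phi|.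
  apply: le_trans (ler_norm _) _; apply: (@dual_norm_ub1 R (dual_space X)).
  by apply: dual_norm_le => x x1; exact: le_trans (g1 x) x1.
by rewrite -gPhi; lra.
Qed.

(** * The canonical embedding is isometric with closed range *)

Lemma canonical_embedding_norm {R : realType} {X : normedModType R} (x : X) :
  `|canonical_embedding x| = `|x|.
Proof.
apply/eqP; rewrite eq_le; apply/andP; split.
  apply: dual_norm_le => f f1 /=; rewrite (le_trans (dual_norm_ub f x))//.
  by rewrite ler_piMl.
have [f fx xf] := exists_dual_norm x.
apply: (le_trans xf); apply: (le_trans (ler_norm _)).
apply: (@dual_norm_ub1 R (dual_space X) (canonical_embedding x) f).
by apply: dual_norm_le => y y1; exact: le_trans (fx y) y1.
Qed.

Lemma canonical_embeddingB {R : realType} {X : normedModType R} (x y : X) :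
  canonical_embedding (x - y) = canonical_embedding x - canonical_embedding y.
Proof. by apply/val_inj/funext => f /=; rewrite dual_spaceB. Qed.

(** If [Phi] were at distance 0 from the range, its sets of approximants [B e] would generate a
    Cauchy filter, by isometry; the embedding would send its limit in [X] to [Phi]. *)
Lemma canonical_embedding_closed {R : realType} {X : completeNormedModType R}
    (Phi : dual_space (dual_space X)) :
  ~ range (@canonical_embedding R X) Phi ->
  exists2 theta : R, 0 < theta &
    forall x, theta < `|Phi - canonical_embedding x|.
Proof.
move=> Phir; apply: contrapT => ntheta; apply: Phir.
have near_range e : 0 < e -> exists x : X, `|Phi - canonical_embedding x| <= e.
  move=> e0; apply: contrapT => nx; apply: ntheta; exists e => // x.
  by rewrite ltNge; apply/negP => xe; apply: nx; exists x.
pose B e := [set x : X | `|Phi - canonical_embedding x| <= e].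
pose F := filter_from [set e : R | 0 < e] B.
have FF : ProperFilter F.
  apply: filter_from_proper => [|e /= e0]; last exact: near_range.
  apply: filter_from_filter; first by exists 1; rewrite /= ltr01.
  move=> a b /= a0 b0; exists (Num.min a b); first by rewrite /= lt_min a0.
  by move=> x; rewrite /B /= le_min => /andP[].
have : cvg F.
  apply: cauchy_cvg; apply: cauchy_exP => e e0.
  have [x xe] := near_range (e / 3) ltac:(lra).
  exists x; exists (e / 3) => [/=|y /= ye]; first by rewrite divr_gt0.
  rewrite -ball_normE /= -canonical_embedding_norm canonical_embeddingB.
  rewrite (_ : _ - _ = (Phi - canonical_embedding y) -
    (Phi - canonical_embedding x)); last by rewrite opprB [RHS]addrC addrA subrK.
  by rewrite (le_lt_trans (ler_normB _ _))//; move: ye; rewrite /B /=; lra.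
move=> /cvg_ex[x Fx]; exists x => //.
apply/eqP; rewrite eq_sym -subr_eq0 -normr_le0; apply/ler_addgt0Pr => e e0.
have e20 : 0 < e / 2 by rewrite divr_gt0.
have : F (ball x (e / 2) `&` B (e / 2)).
  by apply: filterI; [apply: Fx; exact: nbhsx_ballx | exists (e / 2)].
move=> /filter_ex[y []]; rewrite -ball_normE /= => xy ye.
rewrite (_ : _ - _ = (Phi - canonical_embedding y) -
  (canonical_embedding x - canonical_embedding y)); last first.
  by rewrite opprB addrA subrK.
rewrite (le_trans (ler_normB _ _))// -canonical_embeddingB.
by rewrite canonical_embedding_norm; move: ye; rewrite /B /=; lra.
Qed.

(** * James's sequence *)

Fixpoint history {T : Type} (step : seq T -> T) (n : nat) : seq T :=
  if n is m.+1 then step (history step m) :: history step m else [::].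

Lemma step_history {T : eqType} (step : seq T -> T) m n :
  (m < n)%N -> step (history step m) \in history step n.
Proof.
elim: n => // n IH; rewrite ltnS leq_eqVlt inE => /predU1P[->|mn].
  by rewrite eqxx.
by rewrite IH ?orbT.
Qed.

(** Each step first takes [f] annihilating all earlier points with [theta <= Phi f], then uses
    Helly's theorem to find [x] on which all functionals chosen so far, the new one included, agree
    with [Phi]. *)
Lemma james_sequence {R : realType} {X : normedModType R}
    {Phi : dual_space (dual_space X)} {theta : R} :
  0 <= theta -> (forall x, theta < `|Phi - canonical_embedding x|) ->
  exists (x : nat -> X) (f : nat -> dual_space X),
    [/\ (forall n, `|x n| <= `|Phi| + 1), (forall n y, `|f n y| <= `|y|),
      (forall m n, (m <= n)%N -> theta <= f m (x n)) &
      (forall m n, (n < m)%N -> f m (x n) = 0)].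
Proof.
move=> theta0 far.
have /choice[step stepP] (s : seq (dual_space X * X)) :
    exists fx : dual_space X * X,
    [/\ `|fx.1| <= 1, `|fx.2| <= `|Phi| + 1, theta <= Phi fx.1,
      (forall gy, gy \in s -> fx.1 gy.2 = 0) &
      (forall gy, gy \in fx :: s -> gy.1 fx.2 = Phi gy.1)].
  have [f [f1 fPhi fs]] := annihilator_norming (map snd s) theta0 far.
  have [x xM xf] := helly Phi (f :: map fst s).
  exists (f, x); split=> //= gy gys; first by apply: fs; exact: map_f.
  by apply: xf; rewrite (map_f fst gys).
pose u n := step (history step n).
exists (fun n => (u n).2), (fun n => (u n).1).
have uin m n : (m < n)%N -> u m \in history step n by exact: step_history.
split=> [n|n y|m n mn|m n nm].
- by have [] := stepP (history step n).
- have [u1 _ _ _ _] := stepP (history step n).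
  by rewrite (le_trans (dual_norm_ub _ _))// ler_piMl.
- have [_ _ _ _ ->] := stepP (history step n).
    by have [] := stepP (history step m).
  move: mn; rewrite leq_eqVlt inE => /predU1P[->|/uin ->]; last by rewrite orbT.
  by rewrite eqxx.
- by have [_ _ _ + _] := stepP (history step m); apply; exact: uin.
Qed.

(** * Weak topology and weakly compact sets *)

Lemma dual_space_le_norm {R : realType} {X : normedModType R}
  (f : dual_space X) x : `|f x| <= `|f| * `|x|.
Proof. exact: dual_norm_ub. Qed.

Lemma weak_continuous {R : realType} {X : normedModType R} (f : dual_space X) :
  continuous (f : weak_space X -> R).
Proof.
move=> x; have /cvg_sup/(_ f) xf : nbhs (x : weak_space X) --> (x : weak_space X).
  by [].
move=> A /(@initial_continuous X R f x); exact: xf.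
Qed.

Lemma weak_cvg {R : realType} {X : normedModType R} (F : set_system X) (x : X) :
  Filter F -> (forall f : dual_space X, f y @[y --> F] --> f x) ->
  F --> (x : weak_space X).
Proof.
move=> FF Ff; apply/cvg_sup => f A.
move=> [_ [[B Bo <-] Bfx] BA]; apply: (filterS BA).
by apply: (Ff f); exact: open_nbhs_nbhs.
Qed.

Lemma fmap_ultra {T U : Type} (f : T -> U) (F : set_system T) :
  UltraFilter F -> UltraFilter (f @ F).
Proof.
move=> FU; split=> [|G GP FG]; first exact: fmap_proper_filter.
apply/seteqP; split=> // A GA.
have [//|FA] := in_ultra_setVsetC (f @^-1` A) FU.
have : G (A `&` ~` A) by apply: filterI => //; exact: FG.
by rewrite setICr => /filter_ex[].
Qed.

(** Along an ultrafilter on the ball, each [f] has a limit [phi f] in a compact interval. These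
    limits form a bounded functional on the dual, which by reflexivity is evaluation at a point: the
    weak limit. *)
Lemma reflexive_ball_weakly_compact {R : realType} {X : normedModType R}
    (r : R) :
  reflexive_space X -> weakly_compact [set x : X | `|x| <= r].
Proof.
move=> refl; rewrite /weakly_compact compact_ultra => F FU Fr.
have FP : ProperFilter F by exact: ultra_proper.
have /choice[phi phiP] (f : dual_space X) :
    exists l : R, `|l| <= r * `|f| /\ f y @[y --> F] --> l.
  have := @segment_compact R (- (r * `|f|)) (r * `|f|).
  rewrite compact_ultra => /(_ (f y @[y --> F])) [|| l []].
  - exact: fmap_ultra.
  - suff: F (f @^-1` [set` `[- (r * `|f|), r * `|f|]]) by [].
    apply: filterS Fr => y /= yr; rewrite in_itv/= -ler_norml.
    rewrite (le_trans (dual_space_le_norm f y))// mulrC.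
    exact: ler_wpM2r.
  - by rewrite /= in_itv/= -ler_norml => lr fl; exists l.
have lphi : linear (phi : dual_space X -> R^o).
  move=> a f g; have lim1 := (phiP (a *: f + g)).2.
  apply: (cvg_unique _ lim1) => //.
  apply: (@cvgD R R^o X); last exact: (phiP g).2.
  by apply: cvgMl_tmp; exact: (phiP f).2.
have [|Phi Phiphi _] := exists_dual lphi (C := r).
  by move=> f; rewrite (le_trans (ler_norm _))//; exact: (phiP f).1.
have : range (@canonical_embedding R X) Phi by rewrite refl.
move=> [x _ xPhi].
have xphi (f : dual_space X) : f x = phi f by rewrite -Phiphi -xPhi.
exists x; split; last first.
  by apply: weak_cvg => f; rewrite xphi; exact: (phiP f).2.
have [f fx xf] := exists_dual_norm x.
rewrite /= (le_trans xf)// xphi (le_trans (ler_norm _))//.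
rewrite (le_trans (phiP f).1)// ler_piMr//; last first.
  by apply: dual_norm_le => y y1; exact: le_trans (fx y) y1.
(* [r] is nonnegative because the ball, being in a proper filter, is nonempty. *)
by have /filter_ex[y] := Fr; apply: le_trans.
Qed.

(** Completeness of the dual lets Banach-Steinhaus be applied there. The limit is built pointwise,
    and the Cauchy property makes the convergence uniform on the unit ball. *)
Lemma dual_space_cauchy_cvg {R : realType} {X : normedModType R}
    (F : set_system (dual_space X)) :
  ProperFilter F -> cauchy F -> cvg F.
Proof.
move=> FF Fc.
have Fe e : 0 < e -> exists f : dual_space X, F (ball f e).
  by move=> e0; move/cauchyP: Fc; apply.
have /choice[phi phiP] (x : X) : exists l : R, f x @[f --> F] --> l.
  apply/cvg_ex; apply: cauchy_cvg; apply: cauchy_exP => e e0.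
  have x1 : 0 < `|x| + 1 by rewrite ltr_wpDl.
  have [f Ff] := Fe (e / (`|x| + 1)) (divr_gt0 e0 x1).
  exists (f x); suff: F ((fun g : dual_space X => g x) @^-1` ball (f x) e) by [].
  apply: filterS Ff => g; rewrite /= -!ball_normE/= => fg.
  rewrite -[f x - g x]/((f - g) x) (le_lt_trans (dual_space_le_norm _ _))//.
  rewrite (@le_lt_trans _ _ (`|f - g| * (`|x| + 1)))//.
    by rewrite ler_wpM2l// lerDl.
  by rewrite -ltr_pdivlMr.
have lphi : linear (phi : X -> R^o).
  move=> a x y.
  have lim : (fun f : dual_space X => a * f x + f y) @ F --> phi (a *: x + y).
    rewrite (_ : (fun f : dual_space X => _) = (fun f => f (a *: x + y))).
      exact: phiP.
    by apply/funext => f; rewrite dual_spaceD dual_spaceZ.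
  apply: (cvg_unique _ lim) => //.
  apply: (@cvgD R R^o (dual_space X)); last exact: phiP.
  by apply: cvgMl_tmp; exact: phiP.
have phi_ball f e x : F (ball f e) -> `|f x - phi x| <= e * `|x|.
  move=> Ff.
  have lim : `|f x - g x| @[g --> F] --> `|f x - phi x|.
    by apply: cvg_norm; apply: cvgB; [exact: cvg_cst | exact: phiP].
  apply: (cvgr_to_le lim); apply: (@filterS _ F _ (ball f e) _ _ Ff) => g.
  rewrite -ball_normE/= => fg.
  rewrite -[f x - g x]/((f - g) x) (le_trans (dual_space_le_norm _ _))//.
  by rewrite ler_wpM2r// ltW.
have [f1 Ff1] := Fe 1 ltr01.
have [|g gphi _] := exists_dual lphi (C := `|f1| + 1).
  move=> x; have := phi_ball _ _ x Ff1; have := dual_space_le_norm f1 x.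
  rewrite mul1r mulrDl mul1r => f1x /ler_normlP[+ _].
  have := ler_norm (f1 x); lra.
apply/cvg_ex; exists g; apply/cvgrPdist_lt => e e0.
have e20 : 0 < e / 4 by rewrite divr_gt0.
have [f Ff] := Fe _ e20; apply: filterS (Ff) => h; rewrite -ball_normE/= => fh.
rewrite (_ : g - h = (f - h) - (f - g)); last first.
  by rewrite opprB [RHS]addrC addrA subrK.
have fg : `|f - g| <= e / 4.
  apply: dual_norm_le => x x1.
  rewrite -[(f - g) x]/(f x - g x) gphi (le_trans (phi_ball _ _ x Ff))//.
  by rewrite ler_piMr// ltW.
by rewrite (le_lt_trans (ler_normB _ _))//; lra.
Qed.

HB.instance Definition _ (R : realType) (X : normedModType R) :=
  Uniform_isComplete.Build (dual_space X) (@dual_space_cauchy_cvg R X).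

Lemma weakly_compact_norm_le {R : realType} {X : normedModType R} {W : set X} :
  weakly_compact W -> exists M : R, forall x, W x -> `|x| <= M.
Proof.
move=> Wc.
have UB : uniform_bounded
    [set (canonical_embedding x : dual_space X -> R^o) | x in W].
  apply: Banach_Steinhauss => [_ [x Wx <-]|f].
    split; last exact: dual_linear.
    move=> r; exists (`|x| * r) => f fr.
    by rewrite (le_trans (dual_space_le_norm f x))// mulrC ler_wpM2l.
  have fW : compact (f @` W).
    apply: (@continuous_compact (weak_space X)) => //.
    by apply: continuous_subspaceT; exact: weak_continuous.
  have [M [_ fM]] := compact_bounded fW.
  exists (M + 1) => _ [x Wx <-].
  by apply: (fM (M + 1) _ (f x)); [rewrite ltrDl | exists x].
have [M WM] := UB 1.
exists M => x Wx; have [f fx xf] := exists_dual_norm x.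
rewrite (le_trans xf)// (le_trans (ler_norm _))//.
apply: (WM (canonical_embedding x)); first by exists x.
by apply: dual_norm_le => y y1; exact: le_trans (fx y) y1.
Qed.

(** * Uniform convergence, and the escape of James's sequence from weakly compact sets *)

Lemma uniform_cvg0P {R : realType} {T : choiceType} {B : set T}
    (G : R -> T -> R) (F : set_system R) : Filter F ->
  {uniform B, G @ F --> cst 0} <->
  forall e, 0 < e -> \forall t \near F, forall h, B h -> `|G t h| < e.
Proof.
move=> FF; split=> [GB e e0|GB A].
  apply: (GB [set g | forall h, B h -> `|g h| < e]).
  apply/uniform_nbhs; exists [set xy | ball xy.1 e xy.2]; split.
    exact: (entourage_ball _ (PosNum e0)).
  move=> g /= gB h Bh; have := gB h Bh.
  by rewrite -ball_normE /= sub0r normrN.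
move/uniform_nbhs => [E [entE EA]].
have [e /= e0 eE] : exists2 e : R, 0 < e & forall x y : R, ball x e y -> E (x, y).
  move: entE; rewrite -entourage_ballE => -[e /= e0 eE]; exists e => // x y xy.
  exact: (eE (x, y)).
apply: filterS (GB e e0) => t tB; apply: EA => h Bh; apply: eE.
by rewrite -ball_normE /= sub0r normrN; exact: tB.
Qed.

(* A weak cluster point [y] of the points [s *: h] near the tail of [x] would
   satisfy [f m y >= 2 delta] for all [m], and yet be within [3/2 delta] of the
   space of the vectors on which [f m] eventually vanishes. *)
Lemma james_sequence_escapes {R : realType} {X : normedModType R} {x : nat -> X}
    {f : nat -> dual_space X} {delta K : R} {W : set X} :
  0 < delta -> (forall n y, `|f n y| <= `|y|) ->
  (forall m n, (m <= n)%N -> 3 * delta <= f m (x n)) ->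
  (forall m n, (n < m)%N -> f m (x n) = 0) -> weakly_compact W ->
  exists N, forall n s h, (N <= n)%N -> 0 <= s <= K -> W h ->
    delta <= `|s *: h - x n|.
Proof.
move=> delta0 f1 fx fx0 Wc; apply: contrapT => noN.
(* The pairs [(s, h)] with [s *: h] close to the tail of [x] generate a proper filter, which
   clusters in the product of [[0, K]] and [W]. *)
pose A N := [set p : R * weak_space X | [/\ 0 <= p.1 <= K, W p.2 &
  exists2 n, (N <= n)%N & `|p.1 *: (p.2 : X) - x n| < delta]].
pose F := filter_from [set: nat] A.
have FF : ProperFilter F.
  apply: filter_from_proper => [|N _].
    apply: filter_from_filter; first by exists 0%N.
    move=> M N _ _; exists (maxn M N) => // p [sK Wp [n]].
    rewrite geq_max => /andP[Mn Nn] pn.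
    by split; split=> //; exists n.
  apply: contrapT => AN; apply: noN; exists N => n s h Nn sK Wh.
  rewrite leNgt; apply/negP => shn; apply: AN; exists (s, h).
  by split=> //; exists n.
have [] := compact_setX (@segment_compact R 0 K) Wc FF.
  by exists 0%N => // -[s h] [/= sK Wh _]; split=> //=; rewrite in_itv.
move=> [s0 h0] [_ clF].
have cluster_ge (g : dual_space X) c N :
    (forall p, A N p -> c <= p.1 * g p.2) -> c <= g (s0 *: (h0 : X)).
  move=> Ac; rewrite dual_spaceZ leNgt; apply/negP => lt_c.
  have cont : (fun p : R * weak_space X => p.1 * g p.2) @ (s0, h0) --> s0 * g h0.
    apply: cvgM; first exact: cvg_fst.
    by apply: (cvg_comp _ _ cvg_snd); exact: weak_continuous.
  have [||p [/Ac]] := clF (A N) [set p | p.1 * g p.2 < c].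
  - by exists N.
  - exact: (cvgr_lt _ cont).
  - by rewrite leNgt => /negP.
pose V := [set v | exists N, forall m, (N <= m)%N -> f m v = 0].
have sV : submodule V.
  split=> [|a u v [M uM] [N vN]]; first by exists 0%N => m _; exact: dual_space0.
  exists (maxn M N) => m; rewrite geq_max => /andP[Mm Nm].
  by rewrite dual_spaceD dual_spaceZ uM// vN// mulr0 addr0.
have [v [N vN] yv] : exists2 v, V v & `|s0 *: (h0 : X) - v| < 3 / 2 * delta.
  apply: contrapT => nov.
  have [|g [g1 gV gy]] := @dual_separation R X V (s0 *: (h0 : X)) (3 / 2 * delta) sV.
    by move=> v Vv; rewrite leNgt; apply/negP => ?; apply: nov; exists v.
  (* [cluster_ge] transfers lower bounds only; the upper bound [g <= delta] is passed through
     [- g]. *)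
  pose g' : dual_space X := - g; have g'E z : g' z = - g z by [].
  suff : - delta <= g' (s0 *: (h0 : X)) by rewrite g'E; lra.
  apply: (cluster_ge g' _ 0%N) => -[s h] [_ _ [n _ /= shn]].
  rewrite -[leRHS]/(s * - g h) mulrN -dual_spaceZ lerN2.
  have Vx : V (x n) by exists n.+1 => m nm; exact: fx0.
  rewrite -[leLHS]subr0 -(gV _ Vx) -dual_spaceB.
  by rewrite (le_trans (ler_norm _))// (le_trans (g1 _))// ltW.
have : 2 * delta <= f N (s0 *: (h0 : X)).
  apply: (cluster_ge (f N) _ N) => -[s h] [_ _ [n Nn /= shn]].
  rewrite -dual_spaceZ -[s *: h](subrK (x n)) dual_spaceD.
  have := fx _ _ Nn; have := f1 N (s *: h - x n); rewrite ler_norml => /andP[].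
  by move: shn; lra.
have := f1 N (s0 *: (h0 : X) - v); rewrite dual_spaceB vN// subr0.
have := ler_norm (f N (s0 *: (h0 : X))).
move: yv; lra.
Qed.

(** * Distance functions *)

Section distance.
Context {R : realType} {X : normedModType R} (C : set X).

Let dist y := inf [set `|y - c| | c in C].

Lemma distance_le y c : C c -> dist y <= `|y - c|.
Proof. by move=> Cc; apply: ge_inf; [exists 0 => _ [? _ <-] | exists c]. Qed.

Lemma distance_ge y r :
  C !=set0 -> (forall c, C c -> r <= `|y - c|) -> r <= dist y.
Proof.
move=> [c Cc] rC; apply: lb_le_inf; first by exists `|y - c|, c.
by move=> _ [z Cz <-]; exact: rC.
Qed.

Lemma distance_lipschitz : C !=set0 -> lipschitz dist.
Proof.
move=> C0; apply: (@klipschitzW _ _ _ 1).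
  by apply: (@globally_properfilter _ _ (0, 0)).
have le12 y z : dist y <= `|y - z| + dist z.
  rewrite -lerBlDl; apply: distance_ge => // c Cc.
  rewrite lerBlDl (le_trans (distance_le _ _ Cc))//.
  by rewrite -{1}(subrK z y) -addrA ler_normD.
move=> [y z] /= _; rewrite mul1r ler_norml.
have := le12 y z; have := le12 z y; rewrite (distrC z y); lra.
Qed.

End distance.

(** * The counterexample and the equivalences *)

Lemma nonreflexive_distance {R : realType} {X : completeNormedModType R} :
  ~ reflexive_space X ->
  exists f : X -> R, [/\ distance_function f, lipschitz f,
    WH_differentiable f 0 & ~ F_differentiable f 0].
Proof.
move=> nrefl.
have [Phi Phir] : exists Phi, ~ range (@canonical_embedding R X) Phi.
  apply: contrapT => noPhi; apply: nrefl; apply/seteqP; split=> // Phi _.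
  by apply: contrapT => Phir; apply: noPhi; exists Phi.
have [theta theta0 far] := canonical_embedding_closed Phi Phir.
have [x [f [xM f1 fx fx0]]] := james_sequence (ltW theta0) far.
set M := `|Phi| + 1 in xM.
have M0 : 0 < M by rewrite /M ltr_wpDl.
pose delta := theta / 3.
have delta0 : 0 < delta by rewrite divr_gt0.
have fxd m n : (m <= n)%N -> 3 * delta <= f m (x n).
  by move=> /fx; rewrite /delta; lra.
pose tau n : R := n.+1%:R^-1.
have tau0 n : 0 < tau n by rewrite invr_gt0.
pose C := ~` \bigcup_n ball (tau n *: x n) (delta * tau n).
(* [|x n| >= f 0 (x n) >= 3 * delta], so no removed ball contains 0. *)
have C0 : C 0.
  move=> [n _]; rewrite -ball_normE /= subr0 normrZ gtr0_norm// mulrC.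
  rewrite ltr_pM2r// ltNge => /negP; apply.
  have := fxd 0%N n isT; have := f1 0%N (x n).
  have := ler_norm (f 0%N (x n)); lra.
pose d y := inf [set `|y - c| | c in C].
have Cne : C !=set0 by exists 0.
have d_ge0 y : 0 <= d y by apply: distance_ge.
have d_norm y : d y <= `|y| by have := distance_le C y 0 C0; rewrite subr0.
have dC y : C y -> d y = 0.
  move=> Cy; apply/eqP; rewrite eq_le d_ge0 andbT.
  by have := distance_le C y y Cy; rewrite subrr normr0.
have d_bump n : delta * tau n <= d (tau n *: x n).
  apply: distance_ge => // c Cc; rewrite leNgt; apply/negP => cn.
  by apply: Cc; exists n => //; rewrite -ball_normE.
exists d; split; first by exists C.
- exact: distance_lipschitz.
- exists 0 => W Wc; apply/uniform_cvg0P => e e0.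
  (* If [t *: h] lies in ball [n] and [t * e <= d (t *: h)], then
     [t * e <= |t *: h| <= (M + delta) * tau n]; hence this bound [K] on [t / tau n]. *)
  have [N NW] := james_sequence_escapes (K := (M + delta) / e) delta0 f1 fxd fx0 Wc.
  have [B WB] := weakly_compact_norm_le Wc.
  have B0 : 0 < `|B| + 1 by rewrite ltr_wpDl.
  (* Points of ball [n] have norm at least [2 * delta * tau n]; below this threshold on [t], the set
     [t W] misses the balls with [n < N]. *)
  have eta0 : 0 < 2 * delta * tau N / (`|B| + 1) by rewrite divr_gt0// !mulr_gt0.
  near=> t.
  have t0 : 0 < t by near: t; exact: nbhs_right_gt.
  have teta : t < 2 * delta * tau N / (`|B| + 1) by near: t; exact: nbhs_right_lt.
  move=> h Wh; rewrite add0r (dC 0)// -[dual_fun _ _]/(0 : R) !subr0.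
  rewrite normrM (gtr0_norm (_ : 0 < t^-1)) ?invr_gt0// (ger0_norm (d_ge0 _)).
  rewrite ltr_pdivrMl// ltNge; apply/negP => dth.
  have : ~ C (t *: h).
    by move=> /dC dth0; move: dth; rewrite dth0 leNgt mulr_gt0.
  rewrite /C /= => /contrapT[n _]; rewrite -ball_normE /= => near_n.
  have norm_th : `|t *: h| <= (M + delta) * tau n.
    rewrite -[t *: h](subKr (tau n *: x n)) (le_trans (ler_normB _ _))//.
    have := xM n; rewrite -(ler_pM2r (tau0 n)) => xMn.
    rewrite normrZ (gtr0_norm (tau0 n)); lra.
  have s0 : 0 <= t / tau n <= (M + delta) / e.
    rewrite divr_ge0 ?(ltW t0) ?(ltW (tau0 n))//= ler_pdivrMr// mulrAC.
    by rewrite ler_pdivlMr//; move: (d_norm (t *: h)); lra.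
  have snear : `|(t / tau n) *: h - x n| < delta.
    have -> : (t / tau n) *: h - x n = (tau n)^-1 *: (t *: h - tau n *: x n).
      by rewrite scalerBr !scalerA mulVf ?gt_eqF// scale1r mulrC.
    rewrite normrZ gtr0_norm ?invr_gt0// ltr_pdivrMl// mulrC distrC.
    by [].
  have nN : (n < N)%N.
    rewrite ltnNge; apply/negP => Nn.
    by have := NW n _ h Nn s0 Wh; rewrite leNgt snear.
  have tau_lt : tau N < tau n by rewrite ltf_pV2 ?posrE// ltr_nat.
  have fth : 2 * delta * tau n <= `|t *: h|.
    have := f1 0%N (t *: h - tau n *: x n); rewrite distrC in near_n.
    rewrite dual_spaceB (dual_spaceZ _ (tau n)) ler_norml => /andP[+ _].
    have := fxd 0%N n isT; rewrite -(ler_pM2r (tau0 n)).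
    have := f1 0%N (t *: h); have := ler_norm (f 0%N (t *: h)).
    move: near_n; lra.
  move: teta; rewrite ltr_pdivlMr// => teta.
  have : t * `|h| <= t * (`|B| + 1).
    rewrite ler_pM2l//; have := WB h Wh; have := ler_norm B; lra.
  move: fth; rewrite normrZ (gtr0_norm t0).
  have : 2 * delta * tau N < 2 * delta * tau n by rewrite ltr_pM2l// mulr_gt0.
  lra.
- move=> [L /(_ [set h | `|h| <= M])].
  have Mb : bounded_set [set h : X | `|h| <= M].
    exists M; split=> [|r Mr h /= hM]; first exact: num_real.
    exact: le_trans hM (ltW Mr).
  move=> /(_ Mb)/uniform_cvg0P/(_ (delta / 2))[]; first by rewrite divr_gt0.
  move=> r /= r0 rP.
  have [n taun] : exists n, tau n < r.
    by have /filter_ex[n] := near_infty_natSinv_lt (PosNum r0); exists n.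
  have := rP (tau n); rewrite /= sub0r normrN gtr0_norm//.
  move=> /(_ taun (tau0 n)) small.
  (* Testing both [x n] and [- x n] cancels the unknown [L]: the two estimates add up to less than
     [delta * tau n], against [d_bump]. *)
  have xnM : `|- x n| <= M by rewrite normrN.
  have := small _ xnM; have := small _ (xM n).
  rewrite !add0r (dC 0)// !subr0 scalerN dual_spaceN opprK !dual_spaceZ.
  have taun1 : 0 < (tau n)^-1 by rewrite invr_gt0.
  rewrite !normrM !(gtr0_norm taun1) !ltr_pdivrMl//.
  rewrite !ltr_norml => /andP[_ H1] /andP[_ H2].
  by have := d_bump n; have := d_ge0 (- (tau n *: x n)); lra.
Unshelve. all: by end_near. Qed.

Lemma reflexive_WH_F_differentiable {R : realType} {X : completeNormedModType R}
    (f : X -> R) (x : X) :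
  reflexive_space X -> WH_differentiable f x <-> F_differentiable f x.
Proof.
move=> refl; split=> -[L fL]; exists L => B.
  move=> [M [_ BM]].
  (* [bounded_set] gives a bound only for radii strictly above [M], hence [M + 1]. *)
  apply: (@uniform_subset_cvg _ _ _ [set h : X | `|h| <= M + 1]) => [h Bh|].
    by apply: BM => //; rewrite ltrDl.
  by apply: fL; exact: reflexive_ball_weakly_compact.
move=> /weakly_compact_norm_le[M BM]; apply: fL.
exists M; split=> [|r Mr h Bh]; first exact: num_real.
exact: le_trans (BM h Bh) (ltW Mr).
Qed.

Theorem theorem2p1 (R : realType) (X : completeNormedModType R)
  (hX : infinite_dimensional X) :
  let a := reflexive_space X in
  let b := forall f : X -> R, lipschitz f ->
    forall x : X, WH_differentiable f x <-> F_differentiable f x in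
  let c := forall f : X -> R, distance_function f ->
    forall x : X, WH_differentiable f x <-> F_differentiable f x in
  (a <-> b) /\ (a <-> c).
Proof.
move=> a b c; split; split.
- by move=> refl f _ x; exact: reflexive_WH_F_differentiable.
- move=> bX; apply: contrapT => /nonreflexive_distance[f [_ lf WHf]].
  by apply; apply/bX.
- by move=> refl f _ x; exact: reflexive_WH_F_differentiable.
- move=> cX; apply: contrapT => /nonreflexive_distance[f [df _ WHf]].
  by apply; apply/cX.
Qed.
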